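(* Let $X=(X,d,\mu)$ be a metric space equipped with a doubling measure $\mu$. Let $\emptyset\neq E\subset X$ be a closed and porous set, let $\alpha\in\mathbb{R}$ and $w=\delta_E^{-\alpha}$, where $\delta_E(x)=\operatorname{dist}(x,E)$, and let $\underline{\mathrm{co\,dim}}_A(E)$ denote the lower Assouad codimension of $E$. Then (A) for $1<p<\infty$: $w\in A_p$ if and only if $(1-p)\,\underline{\mathrm{co\,dim}}_A(E)<\alpha<\underline{\mathrm{co\,dim}}_A(E)$; (B) $w\in A_1$ if and only if $0\le\alpha<\underline{\mathrm{co\,dim}}_A(E)$.
   Context: $X=(X,d,\mu)$ is a metric space with at least two points, equipped with a Borel measure $\mu$ supported on $X$ such that $0<\mu(B)<\infty$ for every open ball $B=B(x,r)=\{y\in X: d(x,y)<r\}$, $x\in X$, $r>0$. The measure $\mu$ is doubling: there is $C_D>0$ with $\mu(B(x,2r))\le C_D\,\mu(B(x,r))$ for all $x\in X$, $r>0$. A set $E\subset X$ is porous if there is a constant $0<c<1$ such that for every $x\in E$ and all $0<r<2\operatorname{diam}(X)$ there is a point $y\in X$ with $B(y,cr)\subset B(x,r)\setminus E$. For $E\subset X$ and $r>0$ let $E_r=\{x\in X:\operatorname{dist}(x,E)<r\}$. The lower Assouad codimension $\underline{\mathrm{co\,dim}}_A(E)$ is the supremum of all $\rho\ge0$ for which there is a constant $C\ge1$ such that $$\frac{\mu(E_r\cap B(x,R))}{\mu(B(x,R))}\le C\Bigl(\frac rR\Bigr)^{\rho}$$ for every $x\in E$ and all $0<r<R<2\operatorname{diam}(X)$.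 A weight is a measurable function $w$ on $X$ such that $w(x)>0$ for $\mu$-almost every $x\in X$ and $\int_B w\,d\mu<\infty$ for every ball $B\subset X$. For $1<p<\infty$, a weight $w$ belongs to the Muckenhoupt class $A_p$ if there is a constant $A>0$ such that for every ball $B$ in $X$ $$\Bigl(\frac1{\mu(B)}\int_B w\,d\mu\Bigr)\Bigl(\frac1{\mu(B)}\int_B w^{-1/(p-1)}\,d\mu\Bigr)^{p-1}\le A.$$ A weight $w$ belongs to $A_1$ if there is $A>0$ such that for every ball $B$ in $X$ $$\Bigl(\frac1{\mu(B)}\int_B w\,d\mu\Bigr)\operatorname*{ess\,sup}_{y\in B}\frac1{w(y)}\le A.$$ Convention: $\delta_E^{-\alpha}=+\infty$ on $E$ if $\alpha>0$, and $\delta_E^0=1$. *)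

(* Defs.v *)
From HB Require Import structures.
From mathcomp Require Import all_boot all_order all_algebra.
From mathcomp Require Import all_classical all_reals all_analysis.
From mathcomp Require Import measurable_realfun.

Set Implicit Arguments.
Unset Strict Implicit.
Unset Printing Implicit Defensive.

Import Order.TTheory GRing.Theory Num.Theory.
Import numFieldNormedType.Exports.

Local Open Scope classical_set_scope.
Local Open Scope ring_scope.

(* The two structures are a priori unrelated: that the sigma-algebra is the
   Borel one is the separate hypothesis [borel_space]. [measurableType] includes
   a base point, which is harmless as the spaces considered are nonempty. *)
#[short(type="metricMeasurableType")]
HB.structure Definition MetricMeasurable (d : measure_display) (R : numDomainType) :=
  { T of Metric R T & Measurable d T }.

Definition borel_space (d : measure_display) (R : realType)
    (X : metricMeasurableType d R) : Prop :=
  (measurable : set (set X)) = <<s open >>.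

(* [powR] and [poweR] follow a different convention at 0 and +oo for negative
   exponents ([0 `^ s = 0] and [+oo `^ s = +oo]); here
   0^s = +oo and +oo^s = 0 for s < 0, and x^0 = 1 for every x. *)
Definition epow (R : realType) (x : \bar R) (s : R) : \bar R :=
  if s < 0 then ((x `^ (- s))^-1)%E else (x `^ s)%E.

Section metric.
Context {R : realType} {X : metricType R}.
Implicit Types E : set X.

Definition diam E : \bar R :=
  ereal_sup [set (mdist z.1 z.2)%:E | z in E `*` E].

Definition porous E : Prop :=
  exists2 c : R, 0 < c < 1 &
    forall x (r : R), E x -> 0 < r -> (r%:E < 2%:E * diam [set: X])%E ->
      exists y, ball y (c * r) `<=` ball x r `\` E.

Definition neighborhood E (r : R) : set X :=
  [set x | (edist_inf E x < r%:E)%E].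

Definition dist_weight E (alpha : R) (x : X) : \bar R :=
  epow (edist_inf E x) (- alpha).

End metric.

Section measure.
Context {d : measure_display} {R : realType} {X : metricMeasurableType d R}.
Variable mu : {measure set X -> \bar R}.
Local Open Scope ereal_scope.

Definition ball_nondegenerate : Prop :=
  forall (x : X) (r : R), (0 < r)%R -> 0 < mu (ball x r) < +oo.

Definition doubling : Prop :=
  exists2 C : R, (0 < C)%R &
    forall (x : X) (r : R), (0 < r)%R ->
      mu (ball x (2 * r)%R) <= C%:E * mu (ball x r).

Definition codim_bound (E : set X) (rho : R) : Prop :=
  exists2 C : R, (1 <= C)%R &
    forall (x : X) (r r' : R), E x ->
      (0 < r)%R -> (r < r')%R -> r'%:E < 2%:E * diam [set: X] ->
      mu (neighborhood E r `&` ball x r') / mu (ball x r')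
        <= (C * (r / r') `^ rho)%:E.

Definition lower_codimA (E : set X) : \bar R :=
  ereal_sup [set rho%:E | rho in [set rho : R | (0 <= rho)%R /\ codim_bound E rho]].

Definition average (f : X -> \bar R) (B : set X) : \bar R :=
  (mu B)^-1 * \int[mu]_(y in B) f y.

(* [ess_sup] ranges over the whole space; this is its definition relative to B. *)
Definition ess_sup_on (B : set X) (f : X -> \bar R) : \bar R :=
  ereal_inf [set a | \forall y \ae mu, B y -> f y <= a].

Definition weight (w : X -> \bar R) : Prop :=
  [/\ measurable_fun [set: X] w,
      \forall x \ae mu, 0 < w x &
      forall (x : X) (r : R), (0 < r)%R -> \int[mu]_(y in ball x r) w y < +oo].

Definition muckenhoupt (p : R) (w : X -> \bar R) : Prop :=
  weight w /\
  exists2 A : R, (0 < A)%R &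
    forall (x : X) (r : R), (0 < r)%R ->
      average w (ball x r)
      * epow (average (fun y => epow (w y) (- (p - 1)^-1)%R) (ball x r)) (p - 1)
      <= A%:E.

Definition muckenhoupt1 (w : X -> \bar R) : Prop :=
  weight w /\
  exists2 A : R, (0 < A)%R &
    forall (x : X) (r : R), (0 < r)%R ->
      average w (ball x r) * ess_sup_on (ball x r) (fun y => (w y)^-1) <= A%:E.

End measure.

(* Main.v *)
Require Import Defs.
From HB Require Import structures.
From mathcomp Require Import all_boot all_order all_algebra.
From mathcomp Require Import all_classical all_reals all_analysis.
From mathcomp Require Import measurable_realfun.
From mathcomp Require Import ring lra.

Set Implicit Arguments.
Unset Strict Implicit.
Unset Printing Implicit Defensive.

Import Order.TTheory GRing.Theory Num.Theory.
Import numFieldNormedType.Exports.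

Local Open Scope classical_set_scope.
Local Open Scope ring_scope.

(** Write [del] for the distance to [E], [W a] for the weight [del ^ (-a)], and
    [L] for the lower Assouad codimension of [E].

    The corollary reduces to one statement: for [0 <= a], the Aikawa condition

      int_B(z,r) W a <= C r^(-a) mu(B(z,r))    for all z in E, 0 < r < 2 diam X,

    holds if and only if [a < L].

    If [a < L], choose a codimension bound with exponent [rho > a] and cut the
    ball dyadically according to the size of [del]; the resulting series is
    geometric with ratio [2^(a - rho)] ([integral_dist_weight_le]).

    Conversely, the Aikawa condition at [a] yields a codimension bound with an
    exponent strictly larger than [a] ([self_improvement]); this is the heart of
    the proof, and it replaces the usual appeal to Gehring's lemma.
    Let [shell r] be the set [q r <= del < r].  The shells of radii [q^k r] are
    disjoint, so the Aikawa condition and the pigeonhole principle provide, for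
    every ball centred in [E], a scale [k] in a bounded range for which
    [mu (shell (q^k r)) <= e (q^k)^a mu B], with [e] as small as desired
    ([thin_shell]).  By porosity every ball of radius [q^k r] centred in [E]
    contains a ball of comparable size lying in that shell.  Hence the balls of
    radius about [q^k r] needed to cover the neighbourhoods of [E] in [B] have
    total measure at most [M e (q^k)^a mu B].  Repeating the argument in each of
    these balls gains a factor [M e] at each step, and the number of scales
    consumed by a step is bounded, so the gain is a power of the scale
    ([neighborhood_decay]).  For [a = 0] the Aikawa condition is trivial and the
    conclusion is [0 < L] ([lower_codimA_gt0]).

    To pass from balls centred in [E] to arbitrary balls, attach to each ball
    [B] a length [s] such that [del <= s] on [B] and such that either [del] is
    comparable to [s] on [B], or [B] is a sizeable part of [B(z,s)] with [z] in
    [E] ([exists_comparable_scale]).  Then for every [a < L] the average of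
    [W a] on [B] is at most [C s^(-a)] ([average_dist_weight_le]).
    Sufficiency follows: with [b = -a / (p - 1)] one has [w^(-1/(p-1)) = W b],
    and the powers of [s] cancel in the product of the two averages; for [A_1]
    the essential supremum of [1 / w = del ^ a] on [B] is at most [s^a].

    For necessity, at most one of the exponents [a] and [b] is positive.  The
    average of the weight with the nonpositive exponent is bounded below
    because of porosity ([average_dist_weight_ge]), so the Muckenhoupt condition
    becomes the Aikawa condition for the other one,
    and [self_improvement] applies.  In the case of [A_1] a
    negative [a] is excluded because [1 / w] is then essentially unbounded near
    every point of [E] ([muckenhoupt1_ge0]). *)

(** * Real powers and geometric sequences *)

Section real_powers.
Context {R : realType}.
Implicit Types x y s : R.

Lemma le0_ler_powR s x y : s <= 0 -> 0 < x -> x <= y -> y `^ s <= x `^ s.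
Proof.
move=> s0 x0 xy; have y0 := lt_le_trans x0 xy.
rewrite -[s]opprK !(powRN _ (- s)) lef_pV2 ?posrE ?powR_gt0//.
by rewrite ge0_ler_powR ?nnegrE ?oppr_ge0// ltW.
Qed.

Lemma powRV x s : 0 <= x -> (x^-1) `^ s = (x `^ s)^-1.
Proof. by move=> x0; rewrite -powR_inv1// -powRrM mulN1r powRN. Qed.

Lemma powRX x s n : 0 <= x -> (x ^+ n) `^ s = (x `^ s) ^+ n.
Proof.
move=> x0; rewrite -(powR_mulrn n x0) -(powR_mulrn n (powR_ge0 x s)).
by rewrite -!powRrM mulrC.
Qed.

Lemma powR_mulVr x s : 0 < x -> x `^ s * x `^ (- s) = 1.
Proof. by move=> x0; rewrite powRN divff// gt_eqF// powR_gt0. Qed.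

Lemma exists_le_expr2 x : exists n, x <= 2 ^+ n.
Proof.
exists (Num.truncn `|x|).+1; apply: (le_trans (ler_norm x)).
apply: (le_trans (ltW (truncnS_gt _))).
by rewrite -natrX ler_nat ltnW// ltn_expl.
Qed.

(** A small enough exponent makes the loss over a bounded number of scales smaller
    than a prescribed factor. *)
Lemma exists_powR_ge x e : 0 < x < 1 -> 0 < e < 1 ->
  exists2 s, 0 < s & e <= x `^ s.
Proof.
move=> /andP[x0 x1] /andP[e0 e1].
have lx : ln x < 0 by rewrite ln_lt0 ?x0.
have le : ln e < 0 by rewrite ln_lt0 ?e0.
exists (ln e / ln x); first by rewrite nmulr_rgt0// invr_lt0.
by rewrite /powR gt_eqF// divfK ?lt_eqF// lnK.
Qed.

(** Passes from the scales [q ^+ n] to all real scales. *)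
Lemma geometric_bracket (q t : R) : 0 < q <= 2^-1 -> 0 < t < 1 ->
  exists n, q ^+ n.+1 <= t < q ^+ n.
Proof.
move=> /andP[q0 q1] /andP[t0 t1]; have [m tm] := exists_le_expr2 t^-1.
have qt : exists n, q ^+ n <= t.
  exists m; rewrite -[leRHS]invrK -[leLHS]invrK.
  rewrite lef_pV2 ?posrE ?invr_gt0 ?exprn_gt0//.
  rewrite (le_trans tm)// -exprVn lerXn2r ?nnegrE ?invr_ge0 ?(ltW q0)//.
  by rewrite -[2]invrK lef_pV2 ?posrE ?invr_gt0.
have [[|n] qn nmin] := ex_minnP qt; first by move: qn; rewrite expr0 leNgt t1.
by exists n; rewrite qn ltNge; apply/negP => /nmin; rewrite ltnn.
Qed.

Lemma nneseries_geometric_le (c x : R) : 0 <= c -> 0 < x < 1 ->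
  (\sum_(0 <= k <oo) (c * x ^+ k)%:E <= (c / (1 - x))%:E)%E.
Proof.
move=> c0 /andP[x0 x1]; apply: lime_le.
  by apply: is_cvg_nneseries => k _ _; rewrite lee_fin mulr_ge0// exprn_ge0// ltW.
apply: nearW => n; rewrite sumEFin lee_fin.
by apply: geometric_le_lim => //; rewrite ger0_norm// ltW.
Qed.

End real_powers.

(** * The distance to a set *)

Section distance.
Context {R : realType} {X : metricType R}.
Variable E : set X.

Definition dist_to (x : X) : R := fine (edist_inf E x).
Local Notation del := dist_to.

Lemma edist_mdist (x y : X) : edist (x, y) = (mdist x y)%:E.
Proof.
rewrite /edist/=; apply/eqP; rewrite eq_le; apply/andP; split.
  apply/lee_addgt0Pr => e e0; rewrite -EFinD.
  apply: ereal_inf_lbound; exists (mdist x y + e) => //; split=> /=.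
    by rewrite addrC ltr_wpDr// mdist_ge0.
  by rewrite ballEmdist/= ltrDl.
apply: le_ereal_inf_tmp => _ [r [/= r0 +] <-]; rewrite ballEmdist/= lee_fin.
exact: ltW.
Qed.

Hypothesis E0 : E !=set0.

Lemma dist_toE x : edist_inf E x = (dist_to x)%:E.
Proof.
rewrite /dist_to fineK// ge0_fin_numE; last exact: edist_inf_ge0.
case: E0 => a Ea.
apply: le_lt_trans (ltry (mdist x a)); rewrite -edist_mdist.
by apply: ereal_inf_lbound; exists a.
Qed.

Lemma dist_to_ge0 x : 0 <= del x.
Proof. by apply: fine_ge0; exact: edist_inf_ge0. Qed.

Lemma dist_to_lip x y : del x <= mdist x y + del y.
Proof.
by rewrite -lee_fin EFinD -!dist_toE -edist_mdist edist_inf_triangle.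
Qed.

Lemma dist_to_in x : E x -> del x = 0.
Proof. by move=> Ex; rewrite /del edist_inf0. Qed.

Lemma dist_to_le x z : E z -> del x <= mdist x z.
Proof.
by move=> Ez; rewrite (le_trans (dist_to_lip x z))// dist_to_in// addr0.
Qed.

Lemma dist_to_ltP x r : del x < r <-> exists2 z, E z & mdist x z < r.
Proof.
split=> [|[z Ez]]; last exact: le_lt_trans (dist_to_le x Ez).
rewrite -lte_fin -dist_toE => /ereal_inf_lt[_ [z Ez <-]].
by rewrite edist_mdist lte_fin => zr; exists z.
Qed.

Lemma le_dist_to_ball y r : 0 < r -> ball y r `<=` ~` E -> r <= del y.
Proof.
move=> r0 yE; rewrite leNgt; apply/negP => /dist_to_ltP[z Ez yz].
by apply: (yE z) => //; rewrite ballEmdist.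
Qed.

Lemma neighborhoodE r : neighborhood E r = [set x | del x < r].
Proof.
by apply/seteqP; split=> x; rewrite /neighborhood/= dist_toE lte_fin.
Qed.

Lemma open_neighborhood r : open (neighborhood E r).
Proof.
rewrite /neighborhood (_ : mkset _ = edist_inf E @^-1` [set y | (y < r%:E)%E])//.
apply: open_comp; last exact: open_ereal_lt_ereal.
by move=> x _; exact: edist_inf_continuous.
Qed.

Lemma open_mball (x : X) r : open (ball x r).
Proof.
rewrite openE => y; rewrite ballEmdist/= => xy.
apply/nbhs_ballP; exists (r - mdist x y); rewrite /= ?subr_gt0//.
move=> z; rewrite ballEmdist/= => yz.
by rewrite (le_lt_trans (metric_triangle x y z))// -ltrBrDl.
Qed.

Lemma ball_sub (x y : X) r r' : mdist x y + r' <= r -> ball y r' `<=` ball x r.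
Proof.
move=> h z; rewrite !ballEmdist/= => yz.
by rewrite (le_lt_trans (metric_triangle x y z))// (lt_le_trans _ h)// ltrD2l.
Qed.

Lemma diam_gt0 : (exists x y : X, x <> y) -> (0 < diam [set: X])%E.
Proof.
move=> [x [y /eqP xy]]; apply: (@lt_le_trans _ _ (mdist x y)%:E).
  by rewrite lte_fin mdist_gt0.
by apply: ereal_sup_ubound; exists (x, y).
Qed.

Lemma le_diam (x y : X) : ((mdist x y)%:E <= diam [set: X])%E.
Proof. by apply: ereal_sup_ubound; exists (x, y). Qed.

End distance.

(** * Doubling measures and separated nets *)

Section doubling_space.
Context {d : measure_display} {R : realType} {X : metricMeasurableType d R}.
Variable mu : {measure set X -> \bar R}.
Hypothesis hBorel : borel_space X.
Hypothesis hball : ball_nondegenerate mu.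
Hypothesis hdoubling : doubling mu.
Implicit Types (x y z : X) (r s : R) (A B : set X).

Lemma open_measurable A : open A -> measurable A.
Proof. by move=> oA; rewrite hBorel; exact: sub_sigma_algebra. Qed.

Lemma measurable_mball x r : measurable (ball x r : set X).
Proof. exact/open_measurable/open_mball. Qed.

Lemma measurable_neighborhood (E : set X) r : measurable (neighborhood E r).
Proof. exact/open_measurable/open_neighborhood. Qed.

Lemma measurable_dist_to (E : set X) : E !=set0 ->
  measurable_fun [set: X] (dist_to E).
Proof.
move=> E0; apply: (measurability _ (RGenInftyO.measurableE R)) => //.
move=> _ [_ [r ->] <-]; rewrite setTI.
rewrite (_ : _ @^-1` _ = neighborhood E r); first exact: measurable_neighborhood.
by rewrite neighborhoodE//; apply/seteqP; split=> x; rewrite /= in_itv.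
Qed.

Lemma mu_ball_gt0 x r : 0 < r -> (0 < mu (ball x r))%E.
Proof. by move=> /(hball x)/andP[]. Qed.

Lemma mu_ball_lty x r : 0 < r -> (mu (ball x r) < +oo)%E.
Proof. by move=> /(hball x)/andP[]. Qed.

Lemma mu_ball_fin x r : 0 < r -> mu (ball x r) \is a fin_num.
Proof. by move=> r0; rewrite ge0_fin_numE// mu_ball_lty. Qed.

Lemma fine_mu_ball_gt0 x r : 0 < r -> 0 < fine (mu (ball x r)).
Proof. by move=> r0; rewrite fine_gt0// mu_ball_gt0// mu_ball_lty. Qed.

Lemma inve_mu_ball x r : 0 < r ->
  (mu (ball x r))^-1%E = (fine (mu (ball x r)))^-1%:E.
Proof.
move=> r0; rewrite -[in LHS](fineK (mu_ball_fin x r0)) inver gt_eqF//.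
exact: fine_mu_ball_gt0.
Qed.

Lemma le_inve_mu_ball x r (u c : \bar R) : 0 < r ->
  ((mu (ball x r))^-1 * u <= c)%E = (u <= c * mu (ball x r))%E.
Proof.
move=> r0; rewrite inve_mu_ball// lee_pdivrMl ?fine_mu_ball_gt0//.
by rewrite fineK ?mu_ball_fin// muleC.
Qed.

Lemma ge_inve_mu_ball x r (u c : \bar R) : 0 < r ->
  (c <= (mu (ball x r))^-1 * u)%E = (c * mu (ball x r) <= u)%E.
Proof.
move=> r0; rewrite inve_mu_ball// lee_pdivlMl ?fine_mu_ball_gt0//.
by rewrite fineK ?mu_ball_fin// muleC.
Qed.

Lemma mu_sub A B : measurable A -> measurable B -> A `<=` B -> (mu A <= mu B)%E.
Proof. by move=> mA mB AB; rewrite le_measure ?inE. Qed.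

(** The form in which doubling is used: any dilation factor costs a constant. *)
Lemma doubling_dilate K : exists2 M : R, 0 < M &
  forall x r, 0 < r -> (mu (ball x (K * r)) <= M%:E * mu (ball x r))%E.
Proof.
have [C C0 dbl] := hdoubling.
have dbln n x r : 0 < r ->
    (mu (ball x (2 ^+ n * r)) <= (C ^+ n)%:E * mu (ball x r))%E.
  elim: n r => [r r0|n IHn r r0]; first by rewrite !expr0 mul1r mul1e.
  rewrite exprS -mulrA (le_trans (dbl _ _ _))//.
    by rewrite mulr_gt0// exprn_gt0.
  by rewrite exprS EFinM -muleA lee_pmul2l// IHn.
have [n Kn] := exists_le_expr2 K.
exists (C ^+ n) => [|x r r0]; first exact: exprn_gt0.
apply: le_trans (dbln n x r r0); apply: mu_sub; try exact: measurable_mball.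
by apply: ball_sub; rewrite mdistxx add0r ler_wpM2r// ltW.
Qed.

(** Stated for a set function so as to serve both for [mu] and for the
    indefinite integral of a nonnegative function. *)
Lemma sum_disjoint_le (nu : set X -> \bar R) (I : eqType) (e : rel I)
    (l : seq I) (F : I -> set X) A :
  (forall B, measurable B -> 0 <= nu B)%E ->
  (forall B B', measurable B -> measurable B' -> B' `<=` B ->
    nu B = nu (B `\` B') + nu B')%E ->
  pairwise e l -> (forall i j, e i j -> F i `&` F j = set0) ->
  (forall i, i \in l -> measurable (F i)) -> measurable A ->
  (forall i, i \in l -> F i `<=` A) ->
  (\sum_(i <- l) nu (F i) <= nu A)%E.
Proof.
move=> nu0 nuD + eF; elim: l A => [A _ _ mA _|i l IHl A /=].
  by rewrite big_nil nu0.
move=> /andP[/allP il pl] mF mA FA; rewrite big_cons.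
have mFi : measurable (F i) by apply: mF; rewrite mem_head.
rewrite (nuD _ _ mA mFi); last by apply: FA; exact: mem_head.
rewrite addeC leeD2r//.
apply: IHl => // [j jl||j jl y Fjy].
- by apply: mF; rewrite in_cons jl orbT.
- exact: measurableD.
- split; first by apply: FA Fjy; rewrite in_cons jl orbT.
  move=> Fiy; have : (F i `&` F j) y by [].
  by rewrite eF//; exact: il.
Qed.

Lemma sum_mu_disjoint_le (I : eqType) (e : rel I) (l : seq I)
    (F : I -> set X) A :
  pairwise e l -> (forall i j, e i j -> F i `&` F j = set0) ->
  (forall i, i \in l -> measurable (F i)) -> measurable A ->
  (forall i, i \in l -> F i `<=` A) ->
  (\sum_(i <- l) mu (F i) <= mu A)%E.
Proof.
apply: sum_disjoint_le => // B B' mB mB' B'B.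
by rewrite (measureDI mu mB mB') [X in (_ + mu X)%E]setIC (setIidl B'B).
Qed.

Lemma sum_integral_disjoint_le (f : X -> \bar R) (I : eqType) (e : rel I)
    (l : seq I) (F : I -> set X) A :
  measurable_fun setT f -> (forall x, 0 <= f x)%E ->
  pairwise e l -> (forall i j, e i j -> F i `&` F j = set0) ->
  (forall i, i \in l -> measurable (F i)) -> measurable A ->
  (forall i, i \in l -> F i `<=` A) ->
  (\sum_(i <- l) \int[mu]_(x in F i) f x <= \int[mu]_(x in A) f x)%E.
Proof.
move=> mf f0; apply: (sum_disjoint_le (nu := fun B => \int[mu]_(x in B) f x)%E).
  by move=> B _; exact: integral_ge0.
move=> B B' mB mB' B'B; rewrite -ge0_integral_setU//.
- by rewrite setUC setDUK.
- exact: measurableD.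
- exact: measurable_funS mf.
- by apply/disj_setPS => x [[]].
Qed.

Lemma mu_cover (I : eqType) (l : seq I) (F : I -> set X) A :
  (forall i, i \in l -> measurable (F i)) -> measurable A ->
  (forall y, A y -> exists2 i, i \in l & F i y) ->
  (mu A <= \sum_(i <- l) mu (A `&` F i))%E.
Proof.
elim: l A => [A _ _ cA|i l IHl A mF mA cA].
  rewrite (_ : A = set0) ?measure0 ?big_nil//.
  by rewrite -subset0 => y /cA[].
have mFi : measurable (F i) by apply: mF; rewrite mem_head.
have mD : measurable (A `\` F i) by exact: measurableD.
rewrite big_cons (measureDI mu mA mFi) addeC leeD2l//.
apply: (le_trans (IHl (A `\` F i) _ mD _)) => [j jl|y [Ay nFiy]|].
- by apply: mF; rewrite in_cons jl orbT.
- have [j + Fjy] := cA y Ay; rewrite in_cons => /orP[/eqP ji|jl]; last by exists j.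
  by case: nFiy; rewrite -ji.
- rewrite [leLHS]big_seq [leRHS]big_seq; apply: lee_sum => j jl.
  have mFj : measurable (F j) by apply: mF; rewrite in_cons jl orbT.
  by apply: mu_sub => [||y [[]]//]; exact: measurableI.
Qed.

Lemma separated_ball_disjoint x y s : s <= mdist x y ->
  ball x (s / 2) `&` ball y (s / 2) = set0.
Proof.
move=> sxy; rewrite -subset0 => z []; rewrite !ballEmdist/= => xz yz.
have := metric_triangle x z y; rewrite (metric_sym z y) leNgt => /negP; apply.
by apply: lt_le_trans sxy; rewrite [ltRHS]splitr ltrD.
Qed.

(** A separated family of maximal cardinality is a net.  The cardinality is
    bounded because the half-radius balls are disjoint and, by doubling, each
    carries a fixed fraction of the measure of one large ball. *)
Lemma separated_net A z r s : 0 < s -> A `<=` ball z r ->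
  exists l : seq X, [/\ forall x, x \in l -> A x,
    pairwise (fun x y => s <= mdist x y) l &
    forall x, A x -> exists2 y, y \in l & mdist y x < s].
Proof.
move=> s0 Azr; pose r' : R := `|r| + 1.
have r'0 : 0 < r' by rewrite ltr_wpDl.
have rr' : r <= r' by rewrite (le_trans (ler_norm r))// lerDl.
have [M M0 dil] := doubling_dilate ((2 * r' + s) / (s / 2)).
pose sep (l : seq X) := (forall x, x \in l -> A x) /\
  pairwise (fun x y => s <= mdist x y) l.
have s20 : 0 < s / 2 by rewrite divr_gt0.
have size_sep l : sep l -> (size l)%:R <= M.
  move=> [lA lsep].
  have V0 : 0 < r' + s by rewrite addr_gt0.
  rewrite -lee_fin -(@lee_pmul2r _ (mu (ball z (r' + s)))); last 2 first.
  - exact: mu_ball_fin.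
  - exact: mu_ball_gt0.
  apply: (@le_trans _ _ (\sum_(x <- l) (M%:E * mu (ball x (s / 2))))%E).
    rewrite (_ : _ * _ = \sum_(x <- l) mu (ball z (r' + s)))%E; last first.
      rewrite big_const_seq count_predT -(fineK (mu_ball_fin z V0)).
      elim: (size l) => [|n IHn]; rewrite ?mul0e//= -IHn -!EFinM -EFinD.
      by rewrite -natr1 mulrDl mul1r addrC.
    rewrite [leLHS]big_seq [leRHS]big_seq; apply: lee_sum => x xl.
    rewrite (le_trans _ (dil x _ s20))// divfK ?gt_eqF//.
    apply: mu_sub; try exact: measurable_mball.
    apply: ball_sub; rewrite addrA lerD2r mulr2n mulrDl mul1r lerD2r.
    move: (Azr _ (lA _ xl)); rewrite metric_sym ballEmdist/=.
    by move=> /ltW/le_trans; apply.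
  rewrite -ge0_sume_distrr// lee_pmul2l//.
  apply: (sum_mu_disjoint_le lsep) => [x y|x _||x xl].
  - exact: separated_ball_disjoint.
  - exact: measurable_mball.
  - exact: measurable_mball.
  - apply: ball_sub; rewrite lerD//; last by rewrite ler_pdivrMr// ler_pMr// ler1n.
    by move: (Azr _ (lA _ xl)); rewrite ballEmdist/= => /ltW/le_trans; apply.
pose P n := `[< exists2 l, sep l & size l = n >].
have P0 : exists n, P n by exists 0; apply/asboolP; exists nil.
have PM n : P n -> (n <= Num.truncn M)%N.
  move=> /asboolP[l /size_sep lM <-].
  by rewrite -ltnS -(ltr_nat R) (le_lt_trans lM)// truncnS_gt.
have [_ /asboolP[l [lA lsep] <-] lmax] := ex_maxnP P0 PM.
exists l; split=> // x Ax; apply: contrapT => /forall2NP nx.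
suff /lmax : P (size l).+1 by rewrite ltnn.
apply/asboolP; exists (x :: l) => //; split=> [y|/=].
  by rewrite in_cons => /orP[/eqP->//|]; exact: lA.
rewrite lsep andbT; apply/allP => y yl; rewrite leNgt; apply/negP => xy.
by case: (nx y) => //; rewrite metric_sym.
Qed.

(** * Powers of the distance to a set *)

Section dist_weight.
Variable E : set X.
Hypothesis E0 : E !=set0.
Local Notation del := (dist_to E).
Implicit Types a : R.

(** Only the sign of [a] matters at the points of the closure of [E]; everywhere
    else the weight is an ordinary real power. *)
Lemma dist_weightE a x : dist_weight E a x =
  if (del x == 0) && (0 < a) then +oo%E else (del x `^ (- a))%:E.
Proof.
rewrite /dist_weight /epow dist_toE// oppr_lt0 opprK.
case: ifPn => a0; last by rewrite andbF.
rewrite andbT poweR_EFin inver powR_eq0 (gt_eqF a0) andbT.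
by case: ifP => // _; rewrite powRN.
Qed.

Lemma dist_weight_ge0 a x : (0 <= dist_weight E a x)%E.
Proof.
by rewrite dist_weightE; case: ifP => // _; rewrite lee_fin powR_ge0.
Qed.

Lemma measurable_dist_weight a A : measurable_fun A (dist_weight E a).
Proof.
apply: (measurable_funS measurableT) => //.
rewrite (_ : dist_weight E a = fun x =>
  if (del x == 0) && (0 < a) then +oo%E else (del x `^ (- a))%:E); last first.
  by apply/funext => x; rewrite dist_weightE.
apply: measurable_fun_ifT => //.
  apply: measurable_and => //.
  by apply: measurable_fun_eqr => //; exact: measurable_dist_to.
apply/measurable_EFinP/(measurableT_comp (measurable_powR _)).
exact: measurable_dist_to.
Qed.

Lemma dist_weight_le_far a x r : 0 <= a -> 0 < r -> r <= del x ->
  (dist_weight E a x <= (r `^ (- a))%:E)%E.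
Proof.
move=> a0 r0 rx; rewrite dist_weightE gt_eqF/= ?(lt_le_trans r0)// lee_fin.
by rewrite le0_ler_powR// oppr_le0.
Qed.

Lemma dist_weight_le_near a x r : a <= 0 -> del x <= r ->
  (dist_weight E a x <= (r `^ (- a))%:E)%E.
Proof.
move=> a0 xr; rewrite dist_weightE ltNge a0 andbF lee_fin.
by rewrite ge0_ler_powR ?oppr_ge0 ?nnegrE ?(le_trans _ xr) ?dist_to_ge0.
Qed.

Lemma dist_weight_ge_near a x r : 0 <= a -> del x <= r -> 0 < r ->
  ((r `^ (- a))%:E <= dist_weight E a x)%E.
Proof.
move=> a0 xr r0; rewrite dist_weightE; case: ifPn => [_|]; first exact: leey.
rewrite negb_and -leNgt => /orP[x0|a0'].
  by rewrite lee_fin le0_ler_powR ?oppr_le0// lt_neqAle eq_sym x0 dist_to_ge0.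
have -> : a = 0 by apply/le_anti; rewrite a0 a0'.
by rewrite oppr0 !powRr0.
Qed.

Lemma dist_weight_ge_far a x r : a <= 0 -> 0 <= r -> r <= del x ->
  ((r `^ (- a))%:E <= dist_weight E a x)%E.
Proof.
move=> a0 r0 rx; rewrite dist_weightE ltNge a0 andbF lee_fin.
by rewrite ge0_ler_powR ?oppr_ge0 ?nnegrE ?dist_to_ge0.
Qed.

(** The dual weight of a power of the distance is again such a power, including
    at distance [0], where both sides are [+oo], [1] or [0]. *)
Lemma epow_dist_weight a s x : s < 0 ->
  epow (dist_weight E a x) s = dist_weight E (a * s) x.
Proof.
move=> s0; rewrite /epow s0 !dist_weightE.
have s1 : - s != 0 by rewrite oppr_eq0 lt_eqF.
have [x0|x0] := eqVneq (del x) 0; last first.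
  rewrite !andFb poweR_EFin inver powR_eq0 powR_eq0 (negbTE x0)/=.
  by rewrite -powRN opprK -powRrM mulNr.
rewrite !andTb x0 nmulr_lgt0//; have [a0|a0|->] := ltgtP a 0.
- by rewrite powR0 ?oppr_eq0 ?lt_eqF// poweR0r// inve0.
- by rewrite poweRyr// invey powR0// oppr_eq0 mulf_neq0 ?(gt_eqF a0)// lt_eqF.
- by rewrite mul0r oppr0 powRr0 poweR1r inve1.
Qed.

Lemma inve_dist_weight a x :
  ((dist_weight E a x)^-1)%E = dist_weight E (- a) x.
Proof.
rewrite -[- a]mulrN1 -epow_dist_weight ?oppr_lt0// /epow oppr_lt0 ltr01 opprK.
by rewrite poweRe1// dist_weight_ge0.
Qed.

End dist_weight.

(** * Self-improvement of the Aikawa condition *)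

Section self_improvement.
Variable E : set X.
Hypothesis E0 : E !=set0.
Hypothesis hporous : porous E.
Local Notation del := (dist_to E).
Local Notation small r := (r%:E < 2%:E * diam [set: X])%E.

Definition shell (q r : R) : set X := [set x | q * r <= del x < r].

Lemma measurable_shell q r : measurable (shell q r).
Proof.
rewrite (_ : shell q r = neighborhood E r `\` neighborhood E (q * r)).
  by apply: measurableD; exact: measurable_neighborhood.
rewrite !neighborhoodE//; apply/seteqP; split=> x; rewrite /shell/=.
  by move=> /andP[qx xr]; split=> //; rewrite ltNge qx.
by move=> [xr /negP]; rewrite -leNgt xr andbT.
Qed.

(** Halving the porosity constant keeps the points of the hole away from [E], not
    merely outside it, which puts the hole into a shell. *)
Lemma porous_shell : exists2 q, 0 < q < 2^-1 &
  forall z r, E z -> 0 < r -> small r ->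
    exists y, ball y (q * r) `<=` ball z r `&` shell q r.
Proof.
have [c /andP[c0 c1] hc] := hporous.
exists (c / 2); first by rewrite divr_gt0// ltr_pdivrMr// mulVf.
move=> z r Ez r0 rd; have [y hy] := hc z r Ez r0 rd; exists y => x yx.
have cr0 : 0 < c / 2 * r by rewrite mulr_gt0// divr_gt0.
have crE : c * r = c / 2 * r + c / 2 * r by rewrite -mulrDl -splitr.
have xsub : ball x (c / 2 * r) `<=` ball y (c * r).
  apply: ball_sub; rewrite crE lerD2r ltW//.
  by move: yx; rewrite ballEmdist.
have /hy[zx _] : ball y (c * r) x.
  by apply: xsub; rewrite ballEmdist/= mdistxx.
split=> //; rewrite /shell/=; apply/andP; split.
  by apply: le_dist_to_ball => // w /xsub/hy[].
apply/dist_to_ltP => //; exists z => //.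
by move: zx; rewrite ballEmdist/= metric_sym.
Qed.

(** On the shell of radius [q ^+ k * r] the weight is at least
    [(q ^+ k * r) `^ (- a)].  If every shell with [3 <= k < 3 + n] were thick, the
    integral would exceed [n * e * r `^ (- a) * mu (ball z r)], against the
    hypothesis as soon as [C < n * e].  The range starts at [3] because the
    covering balls of [neighborhood_decay] are [q ^- 2] times larger than the
    shell and still have to be smaller than the original ball. *)
Lemma thin_shell (q a C e : R) : 0 < q < 2^-1 -> 0 <= a -> 0 < e ->
  (forall z r, E z -> 0 < r -> small r ->
    (\int[mu]_(y in ball z (4 * r)%R) dist_weight E a y
      <= (C * r `^ (- a))%:E * mu (ball z r))%E) ->
  exists N, forall z r, E z -> 0 < r -> small r ->
    exists2 k, (3 <= k <= N)%N &
      (mu (shell q (q ^+ k * r)%R `&` ball z (4 * r)%R)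
        <= (e * (q ^+ k) `^ a)%:E * mu (ball z r))%E.
Proof.
move=> /andP[q0 q1] a0 e0 hC.
pose n := (Num.truncn (C / e)).+1.
have Cn : C < e * n%:R by rewrite mulrC -ltr_pdivrMr// truncnS_gt.
exists (n.+2) => z r Ez r0 rd; apply: contrapT => /forall2NP hk.
pose S k := shell q (q ^+ k * r) `&` ball z (4 * r).
have mS k : measurable (S k).
  by apply: measurableI; [exact: measurable_shell|exact: measurable_mball].
have q_le1 : q <= 1 by rewrite (le_trans (ltW q1))// invf_le1// ler1n.
have Sdisj i j : i != j -> S i `&` S j = set0.
  wlog ij : i j / (i < j)%N => [H|_].
    rewrite neq_ltn => /orP[ij|ji]; first by apply: H => //; rewrite ltn_eqF.
    by rewrite setIC; apply: H => //; rewrite ltn_eqF.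
  rewrite -subset0 => x [[/andP[ix _] _] [/andP[_ xj] _]].
  have := le_lt_trans ix xj; rewrite ltNge => /negP; apply.
  rewrite mulrA -exprS; apply: ler_wpM2r; first exact: ltW.
  by apply: ler_wiXn2l => //; exact: ltW.
pose m := fine (mu (ball z r)).
have mE : mu (ball z r) = m%:E by rewrite /m fineK// mu_ball_fin.
have m0 : 0 < m by rewrite -lte_fin -mE mu_ball_gt0.
have low k : (3 <= k < 3 + n)%N ->
    ((e * r `^ (- a) * m)%:E <= \int[mu]_(y in S k) dist_weight E a y)%E.
  move=> kn; have qk0 : 0 < q ^+ k * r by rewrite mulr_gt0// exprn_gt0.
  case: (hk k) => [/negP|/negP].
    by case/andP: kn => -> /=; rewrite addSn ltnS => ->.
  rewrite -ltNge mE -EFinM => /ltW hS.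
  apply: (@le_trans _ _ (\int[mu]_(y in S k) ((q ^+ k * r) `^ (- a))%:E)%E).
    rewrite integral_cst//.
    apply: (@le_trans _ _ (((q ^+ k * r) `^ (- a))%:E *
                           (e * (q ^+ k) `^ a * m)%:E)%E); last first.
      by rewrite lee_pmul2l// lte_fin powR_gt0.
    rewrite -EFinM lee_fin powRM ?exprn_ge0 ?(ltW q0) ?(ltW r0)//.
    rewrite [leRHS](_ : _ = e * r `^ (- a) * m *
      ((q ^+ k) `^ a * (q ^+ k) `^ (- a))); last by ring.
    by rewrite powR_mulVr ?exprn_gt0// mulr1.
  apply: ge0_le_integral => // [x _||x [/andP[_ xk] _]].
  - by rewrite lee_fin powR_ge0.
  - exact: measurable_dist_weight.
  - by apply: dist_weight_ge_near => //; exact: ltW.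
have : (\sum_(k <- iota 3 n) (e * r `^ (- a) * m)%:E
        <= (C * r `^ (- a))%:E * mu (ball z r))%E.
  apply: le_trans (hC z r Ez r0 rd).
  apply: (@le_trans _ _
    (\sum_(k <- iota 3 n) \int[mu]_(y in S k) dist_weight E a y)%E).
    rewrite [leLHS]big_seq [leRHS]big_seq; apply: lee_sum => k.
    by rewrite mem_iota => /low.
  apply: (sum_integral_disjoint_le (e := fun i j => i != j)) => //.
  - exact: measurable_dist_weight.
  - exact: dist_weight_ge0.
  - by rewrite -uniq_pairwise iota_uniq.
  - exact: measurable_mball.
  - by move=> k _ x [].
rewrite mE sumEFin big_const_seq count_predT size_iota iter_addr_0 -EFinM lee_fin.
rewrite leNgt => /negP; apply; rewrite -mulr_natr.
rewrite [ltRHS](_ : _ = e * n%:R * (r `^ (- a) * m)); last by ring.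
by rewrite -[C * _ * _]mulrA ltr_pM2r// mulr_gt0// powR_gt0.
Qed.

(** Strong induction on the number [n] of scales.  Up to [N] the factor
    [(q ^+ N) `^ (- p)] makes the bound trivial.  Beyond, a thin shell of radius
    [s = q ^+ k * r] is available; the balls of radius [r' = q ^- 2 * s] around a
    net of [E] cover the neighbourhood, the induction hypothesis applies to each
    of them, and their total measure is at most [M] times that of the thin shell,
    since the cells [ball x s `&` shell q s] are disjoint and, by porosity, fat.
    The hypothesis [M * e <= (q ^+ N) `^ (p - a)] is what closes the induction:
    a step produces the factor [M * e * (q ^+ k) `^ a], which must not exceed
    [(q ^+ k) `^ p]. *)
Lemma neighborhood_decay (q M a p e : R) N : 0 < q < 2^-1 -> 0 <= a -> a <= p ->
  0 < M -> 0 < e ->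
  (forall z r, E z -> 0 < r -> small r ->
    exists y, ball y (q * r) `<=` ball z r `&` shell q r) ->
  (forall x r, 0 < r ->
    (mu (ball x ((q ^- 2 + 1) / q * r)%R) <= M%:E * mu (ball x r))%E) ->
  (forall z r, E z -> 0 < r -> small r ->
    exists2 k, (3 <= k <= N)%N &
      (mu (shell q (q ^+ k * r)%R `&` ball z (4 * r)%R)
        <= (e * (q ^+ k) `^ a)%:E * mu (ball z r))%E) ->
  M * e <= (q ^+ N) `^ (p - a) ->
  forall n z r, E z -> 0 < r -> small r ->
    (mu (neighborhood E (q ^+ n * r)%R `&` ball z r)
      <= ((q ^+ N) `^ (- p) * (q ^+ n) `^ p)%:E * mu (ball z r))%E.
Proof.
move=> /andP[q0 q1] a0 ap M0 e0 hshell hM hthin hMe.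
have p0 : 0 <= p := le_trans a0 ap.
have qX0 k : 0 < q ^+ k by rewrite exprn_gt0.
have qX_ge0 k : 0 <= q ^+ k := ltW (qX0 k).
have q_le1 : q <= 1 by rewrite (le_trans (ltW q1))// invf_le1// ler1n.
(* Leaves room for the radius [3 * s] needed to cover the neighbourhood. *)
have q2 : 4 <= q ^- 2.
  by rewrite -[4]invrK lef_pV2 ?posrE ?invr_gt0// expr2; nra.
have qX_le i j : (i <= j)%N -> q ^+ j <= q ^+ i.
  by move=> ij; rewrite ler_wiXn2l// ltW.
elim/ltn_ind => n IHn z r Ez r0 rd.
have mr := measurable_mball.
have mn := measurable_neighborhood E.
have [nN|Nn] := leqP n N.
  apply: (@le_trans _ _ (mu (ball z r))).
    by apply: mu_sub => //; exact: measurableI.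
  rewrite -[leLHS]mul1e lee_wpmul2r// lee_fin powRN mulrC ler_pdivlMr ?powR_gt0//.
  by rewrite mul1r ge0_ler_powR ?nnegrE ?qX_ge0 ?qX_le.
have [k /andP[k3 kN] hk] := hthin z r Ez r0 rd.
pose s := q ^+ k * r; pose r' := q ^+ (k - 2) * r; pose n' := (n - (k - 2))%N.
have s0 : 0 < s by rewrite mulr_gt0.
have r'0 : 0 < r' by rewrite mulr_gt0.
have sE : r' = q ^- 2 * s.
  rewrite /r' /s mulrA; congr (_ * _).
  by rewrite -[in RHS](@subnK 2 k) ?(ltnW k3)// addnC exprD mulKf// gt_eqF.
have r'r : r' <= r by rewrite ler_piMl ?(ltW r0)// -(expr0 q) qX_le.
have sr : s <= r by rewrite ler_piMl ?(ltW r0)// -(expr0 q) qX_le.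
have srd : small s by apply: le_lt_trans rd; rewrite lee_fin.
have qnE : q ^+ n = q ^+ n' * q ^+ (k - 2).
  by rewrite -exprD subnK// (leq_trans (leq_subr _ _))// (leq_trans kN)// ltnW.
have nE : q ^+ n * r = q ^+ n' * r' by rewrite /r' mulrA -qnE.
have n'n : (n' < n)%N.
  rewrite /n' ltn_subrL subn_gt0 (leq_trans _ k3)//=.
  exact: leq_ltn_trans Nn.
have nk : q ^+ n * r <= s.
  by rewrite ler_wpM2r ?(ltW r0)// qX_le// (leq_trans kN)// ltnW.
have [l [lE lsep lcov]] := separated_net (s := 2 * s) (A := E `&` ball z (2 * r))
  (mulr_gt0 (ltr0Sn _ 1) s0) (@subIsetr _ _ _).
pose A := neighborhood E (q ^+ n * r) `&` ball z r.
pose F x := ball x s `&` shell q s : set X.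
have mA : measurable A by exact: measurableI.
have mF x : measurable (F x) by apply: measurableI => //; exact: measurable_shell.
have AP x : A x -> exists2 y, y \in l & ball y r' x.
  move=> [+ zx]; rewrite neighborhoodE//= => /(dist_to_ltP E0)[x' Ex' xx'].
  move: zx; rewrite ballEmdist/= => zx.
  have zx' : ball z (2 * r) x'.
    rewrite ballEmdist/= (le_lt_trans (metric_triangle z x x'))// mulr2n mulrDl mul1r.
    by rewrite ltrD// (lt_le_trans xx')// (le_trans nk).
  have [y yl yx'] := lcov x' (conj Ex' zx'); exists y => //.
  rewrite ballEmdist/= (le_lt_trans (metric_triangle y x' x))//.
  rewrite (@lt_le_trans _ _ (2 * s + s))//.
    by rewrite ltrD// metric_sym (lt_le_trans xx').
  by rewrite sE; nra.
(* The ball [ball w (q * s)] given by porosity compares [ball y r'] with the cell. *)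
have cell y : y \in l -> (mu (A `&` ball y r') <=
    ((q ^+ N) `^ (- p) * (q ^+ n') `^ p * M)%:E * mu (F y))%E.
  move=> /lE[Ey _].
  apply: (@le_trans _ _ (mu (neighborhood E (q ^+ n' * r') `&` ball y r'))).
    apply: mu_sub; [exact: measurableI|exact: measurableI|].
    by rewrite -nE => x [[]].
  apply: (le_trans (IHn _ n'n y r' Ey r'0 _)).
    by apply: le_lt_trans rd; rewrite lee_fin.
  rewrite [in leRHS]EFinM -muleA lee_wpmul2l ?lee_fin ?mulr_ge0 ?powR_ge0//.
  have [w hw] := hshell y s Ey s0 srd.
  apply: (@le_trans _ _ (M%:E * mu (ball w (q * s)))%E); last first.
    by rewrite lee_wpmul2l ?lee_fin ?(ltW M0)//; exact: mu_sub.
  have qs0 : 0 < q * s by rewrite mulr_gt0.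
  apply: le_trans (hM w (q * s) qs0); apply: mu_sub => //.
  rewrite mulrA divfK ?gt_eqF// mulrDl mul1r -sE; apply: ball_sub.
  rewrite addrC lerD2l ltW//.
  have /hw[+ _] : ball w (q * s) w by rewrite ballEmdist/= mdistxx.
  by rewrite ballEmdist/= metric_sym.
apply: (le_trans (mu_cover (F := fun y => ball y r') (fun y _ => mr y r') mA AP)).
apply: (@le_trans _ _ (\sum_(y <- l)
    ((q ^+ N) `^ (- p) * (q ^+ n') `^ p * M)%:E * mu (F y)))%E.
  by rewrite [leLHS]big_seq [leRHS]big_seq; apply: lee_sum.
rewrite -ge0_sume_distrr//.
apply: (@le_trans _ _ (((q ^+ N) `^ (- p) * (q ^+ n') `^ p * M)%:E *
    mu (shell q s `&` ball z (4 * r))))%E.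
  rewrite lee_wpmul2l ?lee_fin ?mulr_ge0 ?powR_ge0 ?(ltW M0)//.
  apply: (sum_mu_disjoint_le lsep) => // [x y||y /lE[_ zy] x [yx sx]].
  - move=> /separated_ball_disjoint; rewrite mulrAC divff// mul1r => xy0.
    by rewrite -subset0 => w [[xw _] [yw _]]; rewrite -xy0.
  - by apply: measurableI => //; exact: measurable_shell.
  - split=> //; move: zy yx; rewrite !ballEmdist/= => zy yx.
    by rewrite (le_lt_trans (metric_triangle z y x))//; lra.
apply: (@le_trans _ _ (((q ^+ N) `^ (- p) * (q ^+ n') `^ p * M)%:E *
    ((e * (q ^+ k) `^ a)%:E * mu (ball z r))))%E.
  by rewrite lee_wpmul2l ?lee_fin ?mulr_ge0 ?powR_ge0 ?(ltW M0).
rewrite muleA lee_wpmul2r// -EFinM lee_fin -!mulrA ler_wpM2l ?powR_ge0//.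
rewrite qnE powRM ?qX_ge0// ler_wpM2l ?powR_ge0// mulrA.
apply: (@le_trans _ _ ((q ^+ k) `^ (p - a) * (q ^+ k) `^ a)).
  rewrite ler_wpM2r ?powR_ge0// (le_trans hMe)//.
  by rewrite ge0_ler_powR ?nnegrE ?subr_ge0 ?qX_ge0 ?qX_le.
rewrite -powRD ?(gt_eqF (qX0 k)) ?implybT// subrK.
by rewrite ge0_ler_powR ?nnegrE ?qX_ge0 ?qX_le// leq_subr.
Qed.

Lemma codim_boundP (p : R) : codim_bound mu E p <->
  exists2 C : R, 1 <= C & forall z r r', E z -> 0 < r -> r < r' -> small r' ->
    (mu (neighborhood E r `&` ball z r')
      <= (C * (r / r') `^ p)%:E * mu (ball z r'))%E.
Proof.
split=> -[D D1 hD]; exists D => // z r r' Ez r0 rr' rd;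
  have r'0 := lt_trans r0 rr'; have := hD z r r' Ez r0 rr' rd;
  by rewrite [(_ / _)%E]muleC le_inve_mu_ball.
Qed.

(** The choice of constants is not circular: [q] and [M] depend only on porosity
    and doubling, then [e = (2 * M)^-1] fixes the range [N] of scales, and finally
    the gain [s] is taken so small that [(q ^+ N) `^ s] is at least [2^-1].  The
    integral is over [ball z (4 * r)] so that it sees the cells around a net of
    the part of [E] lying near [ball z r]. *)
Lemma self_improvement (a C : R) : 0 <= a ->
  (forall z r, E z -> 0 < r -> small r ->
    (\int[mu]_(y in ball z (4 * r)%R) dist_weight E a y
      <= (C * r `^ (- a))%:E * mu (ball z r))%E) ->
  exists2 p, a < p & codim_bound mu E p.
Proof.
move=> a0 hC; have [q qP hshell] := porous_shell.
have /andP[q0 q1] := qP.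
have [M M0 hM] := doubling_dilate ((q ^- 2 + 1) / q).
have e0 : 0 < (2 * M)^-1 by rewrite invr_gt0 mulr_gt0.
have [N hN] := thin_shell qP a0 e0 hC.
have q11 : q < 1 by rewrite (lt_trans q1)// invf_lt1// ltr1n.
have qN0 : 0 < q ^+ N by rewrite exprn_gt0.
have [s s0 hs] : exists2 s, 0 < s & 2^-1 <= (q ^+ N.+1) `^ s.
  apply: exists_powR_ge; rewrite ?exprn_gt0 ?exprn_ilt1 ?(ltW q0)//.
  by rewrite invr_gt0 ltr0n invf_lt1// ltr1n.
have hMe : M * (2 * M)^-1 <= (q ^+ N) `^ (a + s - a).
  rewrite invfM mulrCA divff ?gt_eqF// mulr1 addrC addKr (le_trans hs)//.
  rewrite ge0_ler_powR ?nnegrE ?exprn_ge0 ?(ltW s0) ?(ltW q0)//.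
  by rewrite ler_wiXn2l ?(ltW q0) ?(ltW q11).
have as0 : a <= a + s by rewrite lerDl ltW.
have dec := neighborhood_decay qP a0 as0 M0 e0 hshell hM hN hMe.
exists (a + s); first by rewrite ltrDl.
have p0 : 0 <= a + s by rewrite (le_trans a0).
apply/codim_boundP; exists ((q ^+ N) `^ (- (a + s)) * q `^ (- (a + s))).
  rewrite -powRM ?(ltW q0) ?(ltW qN0)// powRN.
  rewrite -invf_le1 ?invrK ?invr_gt0 ?powR_gt0 ?mulr_gt0//.
  apply: (@le_trans _ _ (1 `^ (a + s))); last by rewrite powR1.
  rewrite ge0_ler_powR ?nnegrE ?mulr_ge0 ?(ltW qN0) ?(ltW q0)//.
  by rewrite -exprSr exprn_ile1 ?(ltW q0) ?(ltW q11).
move=> z t r Ez t0 tr rd; have r0 := lt_trans t0 tr.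
have [n /andP[qt tq]] : exists n, q ^+ n.+1 <= t / r < q ^+ n.
  by apply: geometric_bracket; [rewrite q0 ltW|rewrite divr_gt0];
    rewrite// ltr_pdivrMr// mul1r.
apply: (@le_trans _ _ (mu (neighborhood E (q ^+ n * r) `&` ball z r))).
  apply: mu_sub; try by apply: measurableI;
    [exact: measurable_neighborhood|exact: measurable_mball].
  rewrite !neighborhoodE// => x [xt xr]; split=> //.
  by apply: (lt_trans xt); rewrite -ltr_pdivrMr.
apply: (le_trans (dec n z r Ez r0 rd)).
rewrite lee_wpmul2r// lee_fin -mulrA ler_wpM2l ?powR_ge0//.
rewrite powRN mulrC ler_pdivlMr ?powR_gt0// -powRM ?exprn_ge0 ?(ltW q0)//.
rewrite -exprSr; apply: ge0_ler_powR => //.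
  by rewrite nnegrE exprn_ge0// ltW.
by rewrite nnegrE divr_ge0// ltW.
Qed.

(** For [a = 0] the Aikawa condition only says that [mu] is doubling. *)
Lemma lower_codimA_gt0 : (0 < lower_codimA mu E)%E.
Proof.
have [M M0 hM] := doubling_dilate 4.
have hC z r : E z -> 0 < r -> small r ->
    (\int[mu]_(y in ball z (4 * r)%R) dist_weight E 0 y
      <= (M * r `^ (- 0))%:E * mu (ball z r))%E.
  move=> Ez r0 rd; rewrite oppr0 powRr0 mulr1; apply: le_trans (hM z r r0).
  rewrite -[leRHS]mul1e -integral_cst; last exact: measurable_mball.
  apply: ge0_le_integral => // [|x _||x _].
  - exact: measurable_mball.
  - exact: dist_weight_ge0.
  - exact: measurable_dist_weight.
  - by rewrite dist_weightE// ltxx andbF oppr0 powRr0.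
have [p p0 hp] := self_improvement (lexx 0) hC.
apply: (@lt_le_trans _ _ p%:E); first by rewrite lte_fin.
by apply: ereal_sup_ubound; exists p => //; split=> //; exact: ltW.
Qed.

End self_improvement.

(** * Averages of the weight below the codimension *)

Section integrability.
Variable E : set X.
Hypothesis E0 : E !=set0.
Local Notation del := (dist_to E).
Local Notation small r := (r%:E < 2%:E * diam [set: X])%E.

(** For [del y > 0] the single term with [2^-1 ^+ n.+1 * r <= del y < 2^-1 ^+ n * r]
    suffices.  For [del y = 0] every indicator is [1], and the series diverges
    because its terms are at least [r `^ (- a)]; so the bound may be
    integrated over the whole ball, points of [E] included. *)
Lemma dist_weight_le_series a z r y : 0 < a -> E z -> 0 < r -> ball z r y ->
  (dist_weight E a y <= \sum_(0 <= k <oo)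
    ((2^-1 ^+ k.+1 * r) `^ (- a))%:E * (\1_(neighborhood E (2^-1 ^+ k * r)) y)%:E)%E.
Proof.
move=> a0 Ez r0 zy; pose h : R := 2^-1.
have h0 : 0 < h by rewrite invr_gt0.
have h1 : h < 1 by rewrite invf_lt1// ltr1n.
have hr k : 0 < h ^+ k * r by rewrite mulr_gt0// exprn_gt0.
pose g k := (((h ^+ k.+1 * r) `^ (- a))%:E *
             (\1_(neighborhood E (h ^+ k * r)) y)%:E)%E : \bar R.
rewrite -[leRHS]/(\sum_(0 <= k <oo) g k)%E.
have g0 k : (0 <= g k)%E by rewrite mule_ge0 ?lee_fin ?powR_ge0.
have le_g n : (g n <= \sum_(0 <= k <oo) g k)%E.
  apply: le_trans (nneseries_lim_ge n.+1 (fun k _ _ => g0 k)).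
  by rewrite big_nat_recr//= leeDr// sume_ge0.
have gE k : del y < h ^+ k * r -> g k = ((h ^+ k.+1 * r) `^ (- a))%:E.
  by move=> yk; rewrite /g indicE mem_set ?mule1// neighborhoodE.
have [y0|y0] := eqVneq (del y) 0; last first.
  have dy0 : 0 < del y by rewrite lt_neqAle eq_sym y0 dist_to_ge0.
  have yr : del y < r.
    apply/dist_to_ltP => //; exists z => //.
    by move: zy; rewrite ballEmdist/= metric_sym.
  have [n /andP[ny yn]] : exists n, h ^+ n.+1 <= del y / r < h ^+ n.
    apply: geometric_bracket; first by rewrite h0 lexx.
    by rewrite divr_gt0// ltr_pdivrMr// mul1r.
  apply: le_trans (le_g n); rewrite gE -?ltr_pdivrMr//.
  by apply: dist_weight_le_far => //; rewrite ?(ltW a0)// -ler_pdivlMr.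
suff -> : (\sum_(0 <= k <oo) g k = +oo)%E by exact: leey.
apply: eq_infty => t; pose c := r `^ (- a).
have c0 : 0 < c by exact: powR_gt0.
apply: le_trans (nneseries_lim_ge (Num.truncn (t / c)).+1 (fun k _ _ => g0 k)).
apply: (@le_trans _ _ (\sum_(0 <= k < (Num.truncn (t / c)).+1) c%:E)%E).
  rewrite sumEFin big_const_seq count_predT size_iota subn0 iter_addr_0 lee_fin.
  by rewrite -mulr_natl -ler_pdivrMr// ltW// truncnS_gt.
apply: lee_sum => k _; rewrite gE ?y0// lee_fin le0_ler_powR ?oppr_le0 ?(ltW a0)//.
by rewrite ler_piMl ?(ltW r0)// exprn_ile1// ltW.
Qed.

(** For [0 < a] the [k]-th term of [dist_weight_le_series] integrates to at most a
    constant times [r `^ (- a) * (2^-1 ^+ k) `^ (p - a)], where [p > a] is the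
    exponent of a codimension bound. *)
Lemma integral_dist_weight_le (a : R) : (a%:E < lower_codimA mu E)%E ->
  exists2 C : R, 0 < C & forall z r, E z -> 0 < r -> small r ->
    (\int[mu]_(y in ball z r) dist_weight E a y
      <= (C * r `^ (- a))%:E * mu (ball z r))%E.
Proof.
have mr := measurable_mball.
have [a0 _|a0] := leP a 0.
  exists 1 => // z r Ez r0 rd; rewrite mul1r -integral_cst//.
  apply: ge0_le_integral => // [x _||x zx].
  - exact: dist_weight_ge0.
  - exact: measurable_dist_weight.
  - apply: dist_weight_le_near => //; apply: ltW.
    apply/dist_to_ltP => //; exists z => //.
    by move: zx; rewrite ballEmdist/= metric_sym.
move=> /ereal_sup_gt[_ [p [p0 /codim_boundP[D D1 hD]] <-]]; rewrite lte_fin => ap.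
have D0 : 0 < D := lt_le_trans ltr01 D1.
pose h : R := 2^-1.
have h0 : 0 < h by rewrite invr_gt0.
have h1 : h < 1 by rewrite invf_lt1// ltr1n.
pose x := h `^ (p - a).
have x01 : 0 < x < 1.
  rewrite powR_gt0//=; have : x < 1 `^ (p - a).
    by apply: gt0_ltr_powR; rewrite ?subr_gt0 ?nnegrE ?(ltW h0) ?ler01.
  by rewrite powR1.
pose C := D * h `^ (- a) / (1 - x).
have x1 : 0 < 1 - x by rewrite subr_gt0; case/andP: x01.
exists C => [|z r Ez r0 rd]; first by rewrite divr_gt0// mulr_gt0// powR_gt0.
have hr k : 0 < h ^+ k * r by rewrite mulr_gt0// exprn_gt0.
pose m := fine (mu (ball z r)).
have mE : mu (ball z r) = m%:E by rewrite /m fineK// mu_ball_fin.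
have m0 : 0 < m by exact: fine_mu_ball_gt0.
pose V k := neighborhood E (h ^+ k * r).
have mV k : measurable (V k) by exact: measurable_neighborhood.
pose c k := (h ^+ k.+1 * r) `^ (- a).
have c0 k : 0 <= c k by exact: powR_ge0.
have mg k : measurable_fun (ball z r) (fun y => ((c k)%:E * (\1_(V k) y)%:E)%E).
  by apply: measurable_funeM; apply/measurable_EFinP; exact: measurable_indic.
apply: (@le_trans _ _ (\int[mu]_(y in ball z r)
    \sum_(0 <= k <oo) ((c k)%:E * (\1_(V k) y)%:E))%E).
  apply: ge0_le_integral => // [y _|||y zy].
  - exact: dist_weight_ge0.
  - exact: measurable_dist_weight.
  - apply: ge0_emeasurable_sum => // k y _ _.
    by rewrite mule_ge0 ?lee_fin.
  - exact: dist_weight_le_series zy.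
rewrite integral_nneseries//; last by move=> k y _; rewrite mule_ge0 ?lee_fin.
apply: (@le_trans _ _ (\sum_(0 <= k <oo)
    (D * h `^ (- a) * r `^ (- a) * m * x ^+ k)%:E)%E); last first.
  rewrite (le_trans (nneseries_geometric_le _ x01))//.
    by rewrite !mulr_ge0 ?powR_ge0 ?(ltW D0) ?(ltW m0).
  rewrite mE -EFinM lee_fin /C.
  by rewrite [leRHS](_ : _ = D * h `^ (- a) * r `^ (- a) * m / (1 - x))//; ring.
apply: lee_nneseries => [k _ _|k _].
  by apply: integral_ge0 => y _; rewrite mule_ge0 ?lee_fin.
rewrite ge0_integralZl_EFin//; last first.
  by apply/measurable_EFinP; exact: measurable_indic.
rewrite integral_indic//.
apply: (@le_trans _ _ ((c k)%:E * ((D * (h ^+ k) `^ p)%:E * m%:E))%E).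
  rewrite lee_wpmul2l ?lee_fin// -mE.
  (* A codimension bound requires distinct radii, so [k = 0] is apart. *)
  have [->|k0] := posnP k.
    rewrite expr0 powR1 mulr1 -[leLHS]mul1e.
    apply: lee_pmul; rewrite ?lee_fin//.
    by apply: mu_sub => //; exact: measurableI.
  have := hD z (h ^+ k * r) r Ez (hr k) _ rd; rewrite mulfK ?gt_eqF//; apply.
  by rewrite gtr_pMl// exprn_ilt1// ?(ltW h0)// -lt0n.
rewrite -!EFinM lee_fin /c /x powRM ?exprn_ge0 ?(ltW h0) ?(ltW r0)//.
rewrite exprS powRM ?exprn_ge0 ?(ltW h0)// -powRX ?(ltW h0)// powRB; last first.
  by rewrite gt_eqF ?implybT// exprn_gt0.
rewrite powRN [(h ^+ k) `^ (- a)]powRN.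
by rewrite [leLHS](_ : _ = D * (h `^ a)^-1 * r `^ (- a) * m *
  ((h ^+ k) `^ p / (h ^+ k) `^ a))//; ring.
Qed.

(** Roughly, [s] is the supremum of the distance to [E] over the ball.  In the
    second alternative [s] has to stay below twice the diameter, where the
    codimension bounds are available, although [r] itself is unrestricted. *)
Definition comparable_scale (M : R) x r (s : R) : Prop :=
  [/\ 0 < s, forall y, ball x r y -> del y <= s &
      (forall y, ball x r y -> s <= 3 * del y) \/
      exists z, [/\ E z, small s, ball x r `<=` ball z s &
                    (mu (ball z s) <= M%:E * mu (ball x r))%E]].

(** A ball far from [E] has [s = 3 / 2 * del x].  Otherwise some [z] in [E] is at
    distance less than [2 * r] from [x] and [s = 3 * r] works, unless [3 * r]
    reaches twice the diameter; then [s] is one and a half diameters and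
    [ball z s] is the whole space. *)
Lemma exists_comparable_scale : (exists x y : X, x <> y) ->
  exists2 M, 0 < M & forall x r, 0 < r -> exists s, comparable_scale M x r s.
Proof.
move=> /diam_gt0 diam0.
(* [ball z (3 * r)] lies in [ball x (5 * r)], and [8 * r] exceeds the diameter when
   [3 * r] is at least twice the diameter. *)
have [M M0 hM] := doubling_dilate 8.
exists M => // x r r0; have [Dr|Dr] := leP (2 * r) (del x).
  exists (3 / 2 * del x); have D0 : 0 < del x by lra.
  split; [lra| |left] => y; rewrite ballEmdist/= => xy.
    by have := dist_to_lip E0 y x; rewrite metric_sym; lra.
  by have := dist_to_lip E0 x y; lra.
move: Dr => /(dist_to_ltP E0)[z Ez xz].
have zb y : ball x r y -> mdist z y < 3 * r.
  rewrite ballEmdist/= => xy.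
  by rewrite (le_lt_trans (metric_triangle z x y))// metric_sym; lra.
have mr := measurable_mball.
have [rd|] := boolP (small (3 * r)).
  exists (3 * r); split=> [|y /zb zy|]; first by rewrite mulr_gt0.
    by rewrite (le_trans (dist_to_le E0 y Ez))// metric_sym ltW.
  right; exists z; split=> // [y /zb|]; first by rewrite ballEmdist.
  apply: le_trans (hM x r r0); apply: mu_sub => //.
  by apply: ball_sub; lra.
rewrite -leNgt => rd.
have [dm dmE] : exists dm : R, diam [set: X] = dm%:E.
  case: (diam [set: X]) rd diam0 => [dm _ _||]; first by exists dm.
  - by rewrite gt0_muley ?lte_fin// leye_eq.
  - by [].
move: rd diam0; rewrite dmE -EFinM lee_fin lte_fin => rd dm0.
have le_dm (y y' : X) : mdist y y' <= dm by rewrite -lee_fin -dmE le_diam.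
exists (3 / 2 * dm); split=> [|y _|]; first lra.
  by rewrite (le_trans (dist_to_le E0 y Ez))// (le_trans (le_dm _ _))//; lra.
right; exists z; split=> // [|y _|].
- by rewrite dmE -EFinM lte_fin; lra.
- by rewrite ballEmdist/=; have := le_dm z y; lra.
- apply: le_trans (hM x r r0); apply: mu_sub => // y _.
  by rewrite ballEmdist/=; have := le_dm x y; lra.
Qed.

Lemma average_dist_weight_le (a M : R) : 0 < M ->
  (a%:E < lower_codimA mu E)%E ->
  exists2 C : R, 0 < C & forall x r s, 0 < r -> comparable_scale M x r s ->
    (average mu (dist_weight E a) (ball x r) <= (C * s `^ (- a))%:E)%E.
Proof.
move=> M0 /integral_dist_weight_le[C C0 hC].
have mr := measurable_mball.
have a3 : 0 < 1 + 3 `^ a :> R by rewrite addr_gt0// powR_gt0.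
exists (C * M + (1 + 3 `^ a)) => [|x r s r0 [s0 xs hs]].
  by rewrite addr_gt0// mulr_gt0.
rewrite /average le_inve_mu_ball//; case: hs => [hs|[z [Ez sd xz zx]]].
  apply: (@le_trans _ _ (((1 + 3 `^ a) * s `^ (- a))%:E * mu (ball x r))%E);
    last first.
    by rewrite lee_wpmul2r// lee_fin ler_wpM2r ?powR_ge0// lerDr mulr_ge0// ltW.
  rewrite -integral_cst//; apply: ge0_le_integral => // [y _||y xy].
  - exact: dist_weight_ge0.
  - exact: measurable_dist_weight.
  have [a0|a0] := leP a 0.
    rewrite (le_trans (dist_weight_le_near E0 a0 (xs y xy)))// lee_fin.
    by rewrite ler_peMl ?powR_ge0// lerDl powR_ge0.
  have s30 : 0 < s / 3 by rewrite divr_gt0.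
  have sy : s / 3 <= del y by rewrite ler_pdivrMr// mulrC hs.
  rewrite (le_trans (dist_weight_le_far E0 (ltW a0) s30 sy))// lee_fin.
  rewrite powRM ?(ltW s0)// powRV// -powRN opprK mulrC.
  by rewrite ler_wpM2r ?powR_ge0// lerDr.
apply: (@le_trans _ _ (\int[mu]_(y in ball z s) dist_weight E a y)%E).
  apply: ge0_subset_integral => //; first exact: measurable_dist_weight.
  by move=> y _; exact: dist_weight_ge0.
apply: (le_trans (hC z s Ez s0 sd)).
apply: (@le_trans _ _ ((C * s `^ (- a))%:E * (M%:E * mu (ball x r)))%E).
  by rewrite lee_wpmul2l// lee_fin mulr_ge0 ?powR_ge0// ltW.
rewrite muleA -EFinM lee_wpmul2r// lee_fin mulrAC ler_wpM2r ?powR_ge0//.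
by rewrite lerDl ltW.
Qed.

Lemma integral_dist_weight_lty (a : R) x r : (exists x y : X, x <> y) ->
  (a%:E < lower_codimA mu E)%E -> 0 < r ->
  (\int[mu]_(y in ball x r) dist_weight E a y < +oo)%E.
Proof.
move=> /exists_comparable_scale[M M0 hM] /(average_dist_weight_le M0)[C C0 hC] r0.
have [s hs] := hM x r r0; have := hC x r s r0 hs.
rewrite /average le_inve_mu_ball// => /le_lt_trans; apply.
by rewrite -(fineK (mu_ball_fin x r0)) -EFinM ltry.
Qed.

(** The weight vanishes only on [[set x | del x = 0]].  That set is negligible since
    [W b] is locally integrable for some [b > 0] and is infinite there. *)
Lemma dist_weight_ae_gt0 (a : R) : (exists x y : X, x <> y) ->
  (0 < lower_codimA mu E)%E ->
  {ae mu, forall x, (0 < dist_weight E a x)%E}.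
Proof.
move=> hX2 /ereal_sup_gt[_ [p [_ hp] <-]]; rewrite lte_fin => p0.
have pL : ((p / 2)%:E < lower_codimA mu E)%E.
  apply: (@lt_le_trans _ _ p%:E).
    by rewrite lte_fin ltr_pdivrMr// ltr_pMr// ltr1n.
  by apply: ereal_sup_ubound; exists p => //; split=> //; exact: ltW.
have [z Ez] := E0; pose Z := [set x | del x = 0].
have mZ : measurable Z.
  rewrite -[Z]setTI.
  exact: (measurable_dist_to E0 measurableT (measurable_set1 (0 : R))).
have Z0 n : mu (Z `&` ball z n.+1%:R) = 0%E.
  have mZn : measurable (Z `&` ball z n.+1%:R).
    by apply: measurableI => //; exact: measurable_mball.
  apply/eqP/negPn/negP => Zn0.
  have := integral_dist_weight_lty z hX2 pL (ltr0Sn R n).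
  rewrite ltNge => /negP; apply.
  apply: (@le_trans _ _
    (\int[mu]_(y in Z `&` ball z n.+1%:R) dist_weight E (p / 2) y)%E).
    rewrite (_ : \int[mu]_(y in _) _ = +oo)%E//.
    rewrite -[RHS](@gt0_mulye _ (mu (Z `&` ball z n.+1%:R))).
      rewrite -integral_cst//; apply: eq_integral => y /set_mem[Zy _].
      by rewrite dist_weightE// Zy eqxx divr_gt0.
    by rewrite lt_neqAle eq_sym Zn0 measure_ge0.
  apply: ge0_subset_integral => //.
  - exact: measurable_mball.
  - exact: measurable_dist_weight.
  - by move=> y _; exact: dist_weight_ge0.
apply: (@negligibleS _ _ _ _ (\bigcup_n (Z `&` ball z n.+1%:R))).
  move=> x /= wx; exists (Num.truncn (mdist z x)) => //; split.
    apply: contrapT => /eqP x0; apply: wx; rewrite dist_weightE//.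
    by rewrite (negbTE x0)/= lte_fin powR_gt0// lt_neqAle eq_sym x0 dist_to_ge0.
  by rewrite ballEmdist/= truncnS_gt.
apply: negligible_bigcup => n; apply/negligibleP; last exact: Z0.
by apply: measurableI => //; exact: measurable_mball.
Qed.

Lemma weight_dist_weight (a : R) : (exists x y : X, x <> y) ->
  (0 < lower_codimA mu E)%E -> (a%:E < lower_codimA mu E)%E ->
  weight mu (dist_weight E a).
Proof.
move=> hX2 L0 aL; split; first exact: measurable_dist_weight.
  exact: dist_weight_ae_gt0.
by move=> x r; exact: integral_dist_weight_lty.
Qed.

Lemma average_ge0 (a : R) x r : (0 <= average mu (dist_weight E a) (ball x r))%E.
Proof.
by rewrite mule_ge0 ?inve_ge0// integral_ge0// => y _; exact: dist_weight_ge0.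
Qed.

(** * The codimension bounds imply the Muckenhoupt conditions *)

Lemma muckenhoupt_dist_weight (a p : R) : (exists x y : X, x <> y) ->
  (0 < lower_codimA mu E)%E -> 1 < p -> (a%:E < lower_codimA mu E)%E ->
  ((a * - (p - 1)^-1)%:E < lower_codimA mu E)%E ->
  muckenhoupt mu p (dist_weight E a).
Proof.
move=> hX2 L0 p1 aL bL; split; first exact: weight_dist_weight.
have q0 : 0 < p - 1 by rewrite subr_gt0.
have [M M0 hM] := exists_comparable_scale hX2.
have [C C0 hC] := average_dist_weight_le M0 aL.
have [D D0 hD] := average_dist_weight_le M0 bL.
exists (C * D `^ (p - 1)) => [|x r r0]; first by rewrite mulr_gt0// powR_gt0.
have [s hs] := hM x r r0; have s0 : 0 < s by case: hs.
have -> : (fun y => epow (dist_weight E a y) (- (p - 1)^-1)) =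
    dist_weight E (a * - (p - 1)^-1).
  by apply/funext => y; rewrite epow_dist_weight// oppr_lt0 invr_gt0.
rewrite /epow ltNge (ltW q0)/=.
apply: (@le_trans _ _ ((C * s `^ (- a))%:E *
    ((D * s `^ (- (a * - (p - 1)^-1)))%:E `^ (p - 1)))%E).
  apply: lee_pmul; rewrite ?average_ge0 ?poweR_ge0//; first exact: hC.
  apply: gt0_ler_poweR; rewrite ?(ltW q0) ?in_itv/= ?average_ge0 ?leey//.
    by rewrite lee_fin mulr_ge0 ?powR_ge0 ?(ltW D0).
  exact: hD.
rewrite poweR_EFin -EFinM lee_fin powRM ?powR_ge0 ?(ltW D0)//.
rewrite -powRrM mulrN opprK divfK ?(gt_eqF q0)//.
rewrite [leLHS](_ : _ = C * D `^ (p - 1) * (s `^ a * s `^ (- a))); last by ring.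
by rewrite powR_mulVr// mulr1.
Qed.

Lemma muckenhoupt1_dist_weight (a : R) : (exists x y : X, x <> y) ->
  (0 < lower_codimA mu E)%E -> 0 <= a -> (a%:E < lower_codimA mu E)%E ->
  muckenhoupt1 mu (dist_weight E a).
Proof.
move=> hX2 L0 a0 aL; split; first exact: weight_dist_weight.
have [M M0 hM] := exists_comparable_scale hX2.
have [C C0 hC] := average_dist_weight_le M0 aL.
exists C => // x r r0; have [s hs] := hM x r r0; have [s0 xs _] := hs.
apply: (@le_trans _ _ ((C * s `^ (- a))%:E * (s `^ a)%:E)%E).
  apply: (@le_trans _ _ (average mu (dist_weight E a) (ball x r) * (s `^ a)%:E)%E).
    rewrite lee_wpmul2l ?average_ge0//; apply: ereal_inf_lbound.
    apply: aeW => y xy; rewrite inve_dist_weight// -[in leRHS](opprK a).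
    by apply: dist_weight_le_near; rewrite ?oppr_le0// xs.
  by rewrite lee_wpmul2r ?lee_fin ?powR_ge0//; exact: hC.
by rewrite -EFinM lee_fin -mulrA [_ * s `^ a]mulrC powR_mulVr// mulr1.
Qed.

(** * The Muckenhoupt conditions imply the codimension bounds *)

Lemma le_ess_sup_on (f : X -> \bar R) A y t (v : \bar R) : 0 < t ->
  ball y t `<=` A -> (forall x, ball y t x -> (v <= f x)%E) ->
  (v <= ess_sup_on mu A f)%E.
Proof.
move=> t0 yA fv; apply: le_ereal_inf_tmp => u /= [N [mN N0 subN]].
rewrite leNgt; apply/negP => uv.
have : (mu (ball y t) <= mu N)%E.
  apply: mu_sub => //; first exact: measurable_mball.
  move=> x yx; apply: subN => /= /(_ (yA x yx)) fu.
  by have := lt_le_trans uv (fv x yx); rewrite ltNge fu.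
by rewrite N0 leNgt mu_ball_gt0.
Qed.

Section necessity.
Hypothesis hporous : porous E.

(** The ball given by porosity carries a fixed fraction of the measure of
    [ball z (4 * r)], and [del] is at least [q * r] there. *)
Lemma average_dist_weight_ge (a : R) : a <= 0 -> exists2 c : R, 0 < c &
  forall z r, E z -> 0 < r -> small r ->
    ((c * r `^ (- a))%:E <= average mu (dist_weight E a) (ball z (4 * r)))%E.
Proof.
move=> a0; have [q /andP[q0 q1] hshell] := porous_shell E0 hporous.
have mr := measurable_mball.
have [M M0 hM] := doubling_dilate (5 / q).
exists (q `^ (- a) / M) => [|z r Ez r0 rd]; first by rewrite divr_gt0// powR_gt0.
have r40 : 0 < 4 * r by rewrite mulr_gt0.
have qr0 : 0 < q * r by rewrite mulr_gt0.
have [y hy] := hshell z r Ez r0 rd.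
have zy : mdist z y < r.
  have /hy[+ _] : ball y (q * r) y by rewrite ballEmdist/= mdistxx.
  by rewrite ballEmdist.
have yz : ball y (q * r) `<=` ball z (4 * r).
  by move=> x /hy[]; rewrite !ballEmdist/=; lra.
rewrite /average ge_inve_mu_ball//.
apply: (@le_trans _ _ (\int[mu]_(x in ball y (q * r)) dist_weight E a x)%E);
  last first.
  apply: ge0_subset_integral => //; first exact: measurable_dist_weight.
  by move=> x _; exact: dist_weight_ge0.
apply: (@le_trans _ _
    (\int[mu]_(x in ball y (q * r)) ((q * r) `^ (- a))%:E)%E); last first.
  apply: ge0_le_integral => // [x _||x /hy[_ /andP[qx _]]].
  - by rewrite lee_fin powR_ge0.
  - exact: measurable_dist_weight.
  - by apply: dist_weight_ge_far => //; exact: ltW.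
rewrite integral_cst//.
apply: (@le_trans _ _ ((q `^ (- a) / M * r `^ (- a))%:E *
    (M%:E * mu (ball y (q * r))))%E).
  rewrite lee_wpmul2l ?lee_fin ?mulr_ge0 ?invr_ge0 ?powR_ge0 ?(ltW M0)//.
  apply: le_trans (hM y _ qr0); apply: mu_sub => //; apply: ball_sub.
  by rewrite mulrA divfK ?(gt_eqF q0)// metric_sym; lra.
rewrite muleA -EFinM lee_wpmul2r// lee_fin powRM ?(ltW q0) ?(ltW r0)//.
by rewrite mulrAC divfK ?(gt_eqF M0).
Qed.

(** The Aikawa condition, in the form delivered by the Muckenhoupt conditions. *)
Lemma lt_lower_codimA (a C : R) : 0 <= a -> 0 <= C ->
  (forall z r, E z -> 0 < r -> small r ->
    (average mu (dist_weight E a) (ball z (4 * r)%R) <= (C * r `^ (- a))%:E)%E) ->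
  (a%:E < lower_codimA mu E)%E.
Proof.
move=> a0 C0 hC; have [M M0 hM] := doubling_dilate 4.
have [z r Ez r0 rd|p ap hp] := self_improvement E0 hporous (C := C * M) a0.
  have r40 : 0 < 4 * r by rewrite mulr_gt0.
  have := hC z r Ez r0 rd; rewrite /average le_inve_mu_ball// => /le_trans; apply.
  apply: (@le_trans _ _ ((C * r `^ (- a))%:E * (M%:E * mu (ball z r)))%E).
    by rewrite lee_wpmul2l ?lee_fin ?mulr_ge0 ?powR_ge0//; exact: hM.
  by rewrite muleA -EFinM mulrAC.
apply: (@lt_le_trans _ _ p%:E); first by rewrite lte_fin.
by apply: ereal_sup_ubound; exists p => //; split=> //; rewrite ltW// (le_lt_trans a0).
Qed.

Lemma muckenhoupt_lt_codim_pos (a p : R) : 1 < p -> 0 <= a ->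
  muckenhoupt mu p (dist_weight E a) -> (a%:E < lower_codimA mu E)%E.
Proof.
move=> p1 a0 [_ [A A0 hA]]; have q0 : 0 < p - 1 by rewrite subr_gt0.
pose b := a * - (p - 1)^-1.
have b0 : b <= 0 by rewrite /b mulrN oppr_le0 mulr_ge0// invr_ge0 ltW.
have [c c0 hc] := average_dist_weight_ge b0.
have c0' : 0 < c `^ (p - 1) by rewrite powR_gt0.
apply: (@lt_lower_codimA a (A / c `^ (p - 1))) => // [|z r Ez r0 rd].
  by rewrite divr_ge0 ?ltW.
have r40 : 0 < 4 * r by rewrite mulr_gt0.
have ra0 : 0 < r `^ a by rewrite powR_gt0.
have := hA z (4 * r) r40.
have -> : (fun y => epow (dist_weight E a y) (- (p - 1)^-1)) = dist_weight E b.
  by apply/funext => y; rewrite epow_dist_weight// oppr_lt0 invr_gt0.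
rewrite /epow ltNge (ltW q0)/= => hA'.
rewrite powRN -mulrA -invfM EFinM lee_pdivlMr ?mulr_gt0//.
apply: le_trans hA'; rewrite lee_wpmul2l ?average_ge0//.
apply: (@le_trans _ _ ((c * r `^ (- b))%:E `^ (p - 1))%E); last first.
  apply: gt0_ler_poweR; rewrite ?(ltW q0) ?in_itv/= ?average_ge0 ?leey//.
    by rewrite lee_fin mulr_ge0 ?powR_ge0 ?(ltW c0).
  exact: hc.
rewrite poweR_EFin lee_fin powRM ?powR_ge0 ?(ltW c0)//.
by rewrite -powRrM /b mulrN opprK divfK ?(gt_eqF q0)// mulrC.
Qed.

Lemma muckenhoupt_lt_codim_neg (a p : R) : 1 < p -> a <= 0 ->
  muckenhoupt mu p (dist_weight E a) ->
  ((a * - (p - 1)^-1)%:E < lower_codimA mu E)%E.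
Proof.
move=> p1 a0 [_ [A A0 hA]]; have q0 : 0 < p - 1 by rewrite subr_gt0.
pose b := a * - (p - 1)^-1; rewrite -/b.
have b0 : 0 <= b by rewrite /b mulr_le0// oppr_le0 invr_ge0 ltW.
have [c c0 hc] := average_dist_weight_ge a0.
apply: (@lt_lower_codimA b ((A / c) `^ (p - 1)^-1)) => // [|z r Ez r0 rd].
  exact: powR_ge0.
have r40 : 0 < 4 * r by rewrite mulr_gt0.
have ra0 : 0 < r `^ (- a) by rewrite powR_gt0.
have := hA z (4 * r) r40.
have -> : (fun y => epow (dist_weight E a y) (- (p - 1)^-1)) = dist_weight E b.
  by apply/funext => y; rewrite epow_dist_weight// oppr_lt0 invr_gt0.
rewrite /epow ltNge (ltW q0)/= => hA'.
have {}hA' : (average mu (dist_weight E b) (ball z (4 * r)) `^ (p - 1)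
    <= (A / c / r `^ (- a))%:E)%E.
  rewrite -mulrA -invfM EFinM lee_pdivlMr ?mulr_gt0// muleC.
  apply: le_trans hA'; rewrite lee_wpmul2r ?poweR_ge0//; exact: hc.
rewrite [leLHS](_ : _ = (average mu (dist_weight E b) (ball z (4 * r))
    `^ (p - 1)) `^ (p - 1)^-1)%E; last first.
  by rewrite -poweRrM divff ?(gt_eqF q0)// poweRe1// average_ge0.
apply: (@le_trans _ _ ((A / c / r `^ (- a))%:E `^ (p - 1)^-1)%E).
  apply: gt0_ler_poweR; rewrite ?invr_ge0 ?(ltW q0) ?in_itv/= ?poweR_ge0 ?leey//.
  by rewrite lee_fin !divr_ge0 ?powR_ge0 ?(ltW A0) ?(ltW c0).
rewrite poweR_EFin lee_fin powRM ?invr_ge0 ?powR_ge0 ?divr_ge0 ?(ltW A0) ?(ltW c0)//.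
by rewrite -powRN opprK -powRrM /b mulrN opprK.
Qed.

Lemma exists_small : (exists x y : X, x <> y) -> exists2 r : R, 0 < r & small r.
Proof.
move=> [x [y /eqP xy]]; exists (mdist x y); first by rewrite mdist_gt0.
have := le_diam x y; have : 0 < mdist x y by rewrite mdist_gt0.
case: (diam _) => [dm||] m0; rewrite ?lee_fin ?leeNy_eq//=.
  by move=> md; rewrite -EFinM lte_fin; lra.
by move=> _; rewrite gt0_muley ?ltry// lte_fin.
Qed.

(** If [a < 0], then [1 / w = del ^ a] is at least [t `^ a] on [ball z t] for every
    [t], while the average of [w] on a fixed ball around [z] is at least some
    [v > 0]; the radius [t] is chosen so that [v * t `^ a] exceeds the constant. *)
Lemma muckenhoupt1_ge0 (a : R) : (exists x y : X, x <> y) ->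
  muckenhoupt1 mu (dist_weight E a) -> 0 <= a.
Proof.
move=> hX2 [_ [A A0 hA]]; rewrite leNgt; apply/negP => a0.
have [r r0 rd] := exists_small hX2; have [z Ez] := E0.
have r40 : 0 < 4 * r by rewrite mulr_gt0.
have [c c0 hc] := average_dist_weight_ge (ltW a0).
pose v := c * r `^ (- a); have v0 : 0 < v by rewrite mulr_gt0// powR_gt0.
pose u := A / v + 1; have u0 : 0 < u by rewrite addr_gt0// divr_gt0.
pose t := Num.min (4 * r) (u `^ a^-1).
have t0 : 0 < t by rewrite lt_min r40 powR_gt0.
have ut : u <= t `^ a.
  have uE : u = (u `^ a^-1) `^ a.
    by rewrite -powRrM mulVf ?(lt_eqF a0)// powRr1// ltW.
  by rewrite [leLHS]uE le0_ler_powR ?(ltW a0)// ge_min lexx orbT.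
have : ((v * u)%:E <= A%:E)%E.
  apply: le_trans (hA z (4 * r) r40); rewrite EFinM; apply: lee_pmul.
  - by rewrite lee_fin ltW.
  - by rewrite lee_fin ltW.
  - exact: hc.
  - apply: (@le_ess_sup_on _ _ z t) => //.
      by apply: ball_sub; rewrite mdistxx add0r ge_min lexx.
    move=> x; rewrite ballEmdist/= => zx; rewrite inve_dist_weight//.
    apply: (@le_trans _ _ (t `^ a)%:E); first by rewrite lee_fin.
    rewrite -[in leLHS](opprK a); apply: dist_weight_ge_near => //.
      by rewrite oppr_ge0 ltW.
    by rewrite (le_trans (dist_to_le E0 x Ez))// metric_sym ltW.
rewrite lee_fin /u mulrDr mulrCA divff ?(gt_eqF v0)// !mulr1 leNgt => /negP; apply.
by rewrite ltrDl.
Qed.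

Lemma muckenhoupt1_lt_codim (a : R) : 0 <= a ->
  muckenhoupt1 mu (dist_weight E a) -> (a%:E < lower_codimA mu E)%E.
Proof.
move=> a0 [_ [A A0 hA]]; have [q /andP[q0 q1] hshell] := porous_shell E0 hporous.
apply: (@lt_lower_codimA a (A / q `^ a)) => // [|z r Ez r0 rd].
  by rewrite divr_ge0 ?powR_ge0 ?ltW.
have r40 : 0 < 4 * r by rewrite mulr_gt0.
have qr0 : 0 < q * r by rewrite mulr_gt0.
have [y hy] := hshell z r Ez r0 rd.
have -> : A / q `^ a * r `^ (- a) = A / (q * r) `^ a.
  by rewrite powRN -mulrA -invfM -powRM ?(ltW q0) ?(ltW r0).
rewrite EFinM lee_pdivlMr ?powR_gt0//; apply: le_trans (hA z (4 * r) r40).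
rewrite lee_wpmul2l ?average_ge0//; apply: (@le_ess_sup_on _ _ y (q * r)) => //.
  by move=> x /hy[]; rewrite !ballEmdist/=; lra.
move=> x /hy[_ /andP[qx _]]; rewrite inve_dist_weight// -[in leLHS](opprK a).
by apply: dist_weight_ge_far => //; rewrite ?oppr_le0// ltW.
Qed.

End necessity.
End integrability.
End doubling_space.

(** Puts the lower bound on [alpha] in terms of the exponent of the dual weight.
    For [L = +oo] both inequalities hold, as [1 - p] is negative. *)
Lemma dual_exponent_lt {R : realType} (p a : R) (L : \bar R) :
  1 < p -> (0 < L)%E ->
  ((1 - p)%:E * L < a%:E)%E = ((a * - (p - 1)^-1)%:E < L)%E.
Proof.
move=> p1; case: L => [l _||//]; last first.
  by move=> _; rewrite lt0_muley ?lte_fin ?subr_lt0// ltNyr ltry.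
have q0 : 0 < p - 1 by rewrite subr_gt0.
rewrite -EFinM !lte_fin mulrN -mulNr ltr_pdivrMr//.
by rewrite -opprB mulNr ltrNl mulrC.
Qed.

(** * The characterization *)

Theorem corollary3p7 (R : realType) (d : measure_display)
  (X : metricMeasurableType d R) (mu : {measure set X -> \bar R})
  (hX2 : exists x y : X, x <> y)
  (hBorel : borel_space X)
  (hball : ball_nondegenerate mu)
  (hdoubling : doubling mu)
  (E : set X) (hE0 : E !=set0) (hEclosed : closed E) (hEporous : porous E)
  (alpha : R) :
  (forall p : R, 1 < p ->
     (muckenhoupt mu p (dist_weight E alpha) <->
      ((1 - p)%:E * lower_codimA mu E < alpha%:E < lower_codimA mu E)%E)) /\
  (muckenhoupt1 mu (dist_weight E alpha) <->
   (0 <= alpha) /\ (alpha%:E < lower_codimA mu E)%E).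
Proof.
have L0 := lower_codimA_gt0 hBorel hball hdoubling hE0 hEporous.
split=> [p p1|]; last first.
  split=> [hw|[a0 aL]]; last exact: muckenhoupt1_dist_weight.
  have a0 := muckenhoupt1_ge0 hBorel hball hdoubling hE0 hEporous hX2 hw.
  by split=> //; exact: muckenhoupt1_lt_codim hw.
rewrite dual_exponent_lt//; split=> [hw|/andP[bL aL]];
  last exact: muckenhoupt_dist_weight.
have q0 : 0 < (p - 1)^-1 by rewrite invr_gt0 subr_gt0.
have [a0|a0] := leP 0 alpha.
  apply/andP; split; last exact: muckenhoupt_lt_codim_pos hw.
  by apply: le_lt_trans L0; rewrite lee_fin mulrN oppr_le0 mulr_ge0// ltW.
apply/andP; split.
  exact: (muckenhoupt_lt_codim_neg _ _ _ _ _ p1 (ltW a0) hw).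
by apply: lt_trans L0; rewrite lte_fin.
Qed.
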